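(* Let $\mathcal{X}$ be a (real or complex) Banach space with $\dim \mathcal{X}\geq 2$, let $\mathcal{N}$ be a nest on $\mathcal{X}$ such that each $N\in\mathcal{N}$ with $N_{-}=N$ is complemented in $\mathcal{X}$, and let $\psi: Alg\mathcal{N}\rightarrow Alg\mathcal{N}$ be a linear map. (i) $\psi$ is a local right centralizer if and only if $\psi$ is a right centralizer. (ii) $\psi$ is a local left centralizer if and only if $\psi$ is a left centralizer.
   Context: A nest $\mathcal{N}$ on a Banach space $\mathcal{X}$ is a chain (under inclusion) of norm-closed subspaces of $\mathcal{X}$ containing $\{0\}$ and $\mathcal{X}$ such that for every family $\{N_i\}$ of elements of $\mathcal{N}$, both $\bigcap N_i$ and $\bigvee N_i$ (the closed linear span of the $N_i$) belong to $\mathcal{N}$. The nest algebra $Alg\mathcal{N}$ is the algebra of all bounded linear operators on $\mathcal{X}$ that leave every member of $\mathcal{N}$ invariant. For $N\in\mathcal{N}$, $N_{-}:=\bigvee\{M\in\mathcal{N} : M\subsetneq N\}$. For an algebra $\mathcal{A}$, a linear map $\rho:\mathcal{A}\to\mathcal{A}$ is a right (respectively left) centralizer if $\rho(ab)=a\rho(b)$ (respectively $\rho(ab)=\rho(a)b$) for all $a,b\in\mathcal{A}$. A linear map $\psi:\mathcal{A}\to\mathcal{A}$ is a local right (left) centralizer if for each $a\in\mathcal{A}$ there is a right (left) centralizer $\rho_a:\mathcal{A}\to\mathcal{A}$, depending on $a$, with $\psi(a)=\rho_a(a)$. Linear maps are linear over the scalar field of $\mathcal{X}$ and are not assumed continuous.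 *)

(* Defs.v *)
From HB Require Import structures.
From mathcomp Require Import all_boot all_order all_algebra complex.
From mathcomp Require Import boolp classical_sets functions reals.
From mathcomp Require Import topology normedtype.

Set Implicit Arguments.
Unset Strict Implicit.
Unset Printing Implicit Defensive.

Import Order.TTheory GRing.Theory Num.Theory.
Import numFieldNormedType.Exports.

Local Open Scope classical_set_scope.
Local Open Scope ring_scope.

(* The two possible scalar fields of a Banach space.  A normed space over R[i]
   has its norm in R[i], where `0 <= z` forces z to be real. *)
Definition scalars (R : realType) (is_complex : bool) : numFieldType :=
  if is_complex then (R[i] : numFieldType) else (R : numFieldType).

Section Subspaces.
Variables (K : numFieldType) (X : normedModType K).
Implicit Types (N M A : set X).

Definition subspace N : Prop := submod_closed [in N].

Definition closed_subspace N : Prop := subspace N /\ closed N.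

Definition closed_span A : set X := closure (smallest subspace A).

Definition complemented N : Prop :=
  exists M, [/\ closed_subspace M, N `&` M = [set 0]
              & [set x + y | x in N & y in M] = setT].

Definition dim_ge2 : Prop :=
  exists x y : X, forall a b : K, a *: x + b *: y = 0 -> a = 0 /\ b = 0.

Definition bounded_operator (f : X -> X) : Prop :=
  linear f /\ exists2 C : K, 0 <= C & forall x, `|f x| <= C * `|x|.

End Subspaces.

Section Nests.
Variables (K : numFieldType) (X : normedModType K).

Definition nest_join (F : set (set X)) : set X :=
  closed_span (\bigcup_(N in F) N).

Record is_nest (NN : set (set X)) : Prop := IsNest {
  nest_closed_subspace : forall N, NN N -> closed_subspace N;
  nest_chain : forall M N, NN M -> NN N -> M `<=` N \/ N `<=` M;
  nest_zero : NN [set 0];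
  nest_full : NN setT;
  nest_bigcap : forall F : set (set X), F `<=` NN -> NN (\bigcap_(N in F) N);
  nest_bigjoin : forall F : set (set X), F `<=` NN -> NN (nest_join F) }.

Record nest : Type := Nest {
  nest_members :> set X -> Prop;
  nestP : is_nest nest_members }.

(* N_- *)
Definition nest_pred (NN : nest) (N : set X) : set X :=
  nest_join [set M | NN M /\ M `<` N].

Definition nest_operators (NN : nest) : set (X -> X) :=
  [set f | bounded_operator f /\ forall N, NN N -> f @` N `<=` N].

End Nests.

Section NestAlgebra.
Variables (K : numFieldType) (X : normedModType K) (NN : nest X).

Record Alg : Type := MkAlg {
  alg_fun :> X -> X;
  alg_funP : alg_fun \in nest_operators NN }.

HB.instance Definition _ := [isSub of Alg for alg_fun].
HB.instance Definition _ := [Choice of Alg by <:].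

Lemma nest_operators_submod : subsemimod_closed [in nest_operators NN].
Proof.
have sub N : NN N -> N 0 /\ forall a x y, N x -> N y -> N (a *: x + y).
  move=> /(nest_closed_subspace (nestP NN))[[N0 NS] _].
  split=> [|a x y Nx Ny]; first exact: set_mem.
  by apply: set_mem; apply: NS; apply: mem_set.
split; first split.
- apply: mem_set; split=> [|N /sub[N0 _] _ [x _ <-]//].
  split=> [a x y|]; first by rewrite /= scaler0 addr0.
  by exists 0 => // x; rewrite mul0r normr0.
- move=> f g /set_mem[[fL [C C0 fC]] fN] /set_mem[[gL [D D0 gD]] gN].
  apply: mem_set; split=> [|N NN_ _ [x Nx <-]].
    split=> [a x y|]; first by rewrite /= !fctE fL gL scalerDr addrACA.
    exists (C + D) => [|x]; first exact: addr_ge0.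
    by rewrite fctE (le_trans (ler_normD _ _))// mulrDl lerD.
  have [_ NS] := sub N NN_.
  rewrite fctE -[f x]scale1r; apply: NS; first by apply: (fN N NN_); exists x.
  by apply: (gN N NN_); exists x.
- move=> c f /set_mem[[fL [C C0 fC]] fN].
  apply: mem_set; split=> [|N NN_ _ [x Nx <-]].
    split=> [a x y|].
      by rewrite /= !fctE fL scalerDr !scalerA mulrC.
    exists (`|c| * C) => [|x]; first exact: mulr_ge0.
    by rewrite fctE normrZ -mulrA ler_wpM2l.
  have [N0 NS] := sub N NN_.
  rewrite fctE -[_ *: _]addr0; apply: NS => //.
  by apply: (fN N NN_); exists x.
Qed.

HB.instance Definition _ :=
  GRing.SubChoice_isSubLmodule.Build K (X -> X) [in nest_operators NN] Alg
    nest_operators_submod.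

Lemma nest_operators_id : (id : X -> X) \in nest_operators NN.
Proof.
apply: mem_set; split=> [|N _ _ [x Nx <-]//].
by split=> //; exists 1 => // x; rewrite mul1r.
Qed.

Lemma nest_operators_comp (f g : X -> X) :
  f \in nest_operators NN -> g \in nest_operators NN ->
  f \o g \in nest_operators NN.
Proof.
move=> /set_mem[[fL [C C0 fC]] fN] /set_mem[[gL [D D0 gD]] gN].
apply: mem_set; split=> [|N NN_ _ [x Nx <-]].
  split=> [a x y|]; first by rewrite /= gL fL.
  exists (C * D) => [|x /=]; first exact: mulr_ge0.
  by rewrite (le_trans (fC _))// -mulrA ler_wpM2l.
by apply: (fN N NN_); exists (g x) => //; apply: (gN N NN_); exists x.
Qed.

Definition alg_one : Alg := MkAlg nest_operators_id.

Definition alg_mul (f g : Alg) : Alg :=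
  MkAlg (nest_operators_comp (alg_funP f) (alg_funP g)).

Let alg_linear (f : Alg) : linear f.
Proof. by case: f => f /= /set_mem[[]]. Qed.

Let alg_mulA : associative alg_mul. Proof. by move=> f g h; exact: val_inj. Qed.
Let alg_mul1r : left_id alg_one alg_mul.
Proof. by move=> f; exact: val_inj. Qed.
Let alg_mulr1 : right_id alg_one alg_mul.
Proof. by move=> f; exact: val_inj. Qed.
Let alg_mulDl : left_distributive alg_mul +%R.
Proof. by move=> f g h; exact: val_inj. Qed.
Let alg_mulDr : right_distributive alg_mul +%R.
Proof.
move=> f g h; apply: val_inj; apply/funext => x /=.
by have := alg_linear f 1 (g x) (h x); rewrite !scale1r.
Qed.

HB.instance Definition _ := GRing.Zmodule_isPzRing.Build Alg
  alg_mulA alg_mul1r alg_mulr1 alg_mulDl alg_mulDr.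

End NestAlgebra.

Section Centralizers.
Variables (K : numFieldType) (X : normedModType K) (NN : nest X).
Local Notation A := (Alg NN).

Definition right_centralizer (rho : {linear A -> A}) : Prop :=
  forall a b, rho (a * b) = a * rho b.

Definition left_centralizer (rho : {linear A -> A}) : Prop :=
  forall a b, rho (a * b) = rho a * b.

Definition local_right_centralizer (psi : {linear A -> A}) : Prop :=
  forall a, exists2 rho : {linear A -> A}, right_centralizer rho & psi a = rho a.

Definition local_left_centralizer (psi : {linear A -> A}) : Prop :=
  forall a, exists2 rho : {linear A -> A}, left_centralizer rho & psi a = rho a.

End Centralizers.

(* Main.v *)
From HB Require Import structures.
From mathcomp Require Import all_boot all_algebra classical_sets reals normedtype.
From mathcomp Require Import all_order complex boolp functions topology sequences.
From mathcomp Require Import ring.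
Require Import Defs.

Set Implicit Arguments.
Unset Strict Implicit.
Unset Printing Implicit Defensive.

Import Order.TTheory GRing.Theory Num.Theory.
Import numFieldNormedType.Exports.

Local Open Scope classical_set_scope.
Local Open Scope ring_scope.

(** A right centralizer of a unital algebra is right multiplication by its
    value at [1], so a local right centralizer [psi] is a linear map with
    [psi a] in [a * A] for every [a], and the claim is that
    [psi a = a * psi 1].  The left case is the mirror image.

    Idempotents see the local hypothesis: for [e] idempotent, [psi (e * b)] lies
    in [e * A] and [psi ((1 - e) * b)] in [(1 - e) * A], and their sum is
    [psi b], so [psi (e * b) = e * psi b].  This equation then
    holds with [e] replaced by any [t] in the linear span of the idempotents.

    In a nest algebra this span contains every rank one operator [z (x) f], with
    [z] in [N] and [f] vanishing on [N_-] ([rank_one_idempotent_span]).  If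
    [f z != 0] the operator is a multiple of an idempotent.  If [N_- != N], a
    vector [y] of [N] and a functional [g] vanishing on [N_-] with [g y = 1]
    correct the operators with [f z = 0].  If [N_- = N], then every [z (x) f]
    squares to zero; this is where the complement of [N] enters: for [p] the
    bounded projection onto [N] along it, [p] and [p + z (x) f] are both
    idempotents of the algebra.

    As [r * a] is of the same rank one form as [r],
    [r * psi a = psi (r * a) = r * (a * psi 1)] for every rank one [r], so it
    remains to see that no nonzero [t] in the algebra is killed by all of
    them ([right_separation], [left_separation]).  On the left of [t] they force
    the range of [t] into [N_-] for each [N != 0], and these subspaces
    intersect in [0]; on the right they force [t] to vanish on each [N] with
    [N_- != X], and these span a dense subspace.

    Two theorems of functional analysis are needed for real and complex
    scalars alike: the separation of a closed subspace from a point by a bounded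
    functional, and the boundedness of the projection along a closed
    complement.  Both are proved over the reals, from Zorn's lemma and
    from Baire's theorem, and carried over to a complex Banach space by viewing
    it as a real one ([realified]). *)

(** * The Hahn-Banach theorem *)

Section Functionals.
Variables (K : pzRingType) (V : lmodType K) (f : V -> K).
Hypothesis fL : scalar f.

Lemma functional0 : f 0 = 0.
Proof. by have := fL (-1) 0 0; rewrite scaler0 addr0 mulN1r addNr. Qed.

Lemma functionalZ c x : f (c *: x) = c * f x.
Proof. by have := fL c x 0; rewrite addr0 functional0 addr0. Qed.

Lemma functionalD x y : f (x + y) = f x + f y.
Proof. by have := fL 1 x y; rewrite scale1r mul1r. Qed.

Lemma functionalN x : f (- x) = - f x.
Proof. by rewrite -scaleN1r functionalZ mulN1r. Qed.

End Functionals.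

Section HahnBanach.
Variables (R : realType) (V : lmodType R).
Implicit Types (p q : V -> R) (a x y : V).

Definition sublinear p : Prop :=
  (forall x y, p (x + y) <= p x + p y) /\
  (forall c x, 0 <= c -> p (c *: x) <= c * p x).

Lemma sublinear0 p : sublinear p -> p 0 = 0.
Proof.
move=> [pD pZ]; apply/eqP; rewrite eq_le.
have := pZ 0 0 (lexx _); rewrite scale0r mul0r => -> /=.
by have := pD 0 0; rewrite addr0 lerDl.
Qed.

Lemma sublinear_ge p x : sublinear p -> - p (- x) <= p x.
Proof.
move=> pS; have [pD _] := pS.
by rewrite lerNl -subr_ge0 opprK addrC -(sublinear0 pS) -[X in p X](subrr x) pD.
Qed.

(** This is the largest sublinear [r <= q] with [r (- a) <= - q a]: such an [r]
    satisfies [r x <= r (x + t *: a) + t * r (- a)] for every [t >= 0]. *)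
Definition tilt q a x : R :=
  inf [set q (x + t *: a) - t * q a | t in [set t | 0 <= t]].

Lemma tilt_le q a x t : sublinear q -> 0 <= t ->
  tilt q a x <= q (x + t *: a) - t * q a.
Proof.
move=> qS t0; apply: ge_inf; last by exists t.
have [qD qZ] := qS.
exists (- q (- x)) => _ [s /= s0 <-].
rewrite lerBrDr addrC lerBlDr -subr_ge0.
have qsa : q (s *: a) <= q (x + s *: a) + q (- x).
  by rewrite (le_trans _ (qD _ _))// addrAC subrr add0r.
rewrite subr_ge0 (le_trans _ qsa)//.
have [->|sN0] := eqVneq s 0; first by rewrite mul0r scale0r sublinear0.
have sgt0 : 0 < s by rewrite lt_neqAle eq_sym sN0.
have := qZ s^-1 (s *: a); rewrite invr_ge0 => /(_ s0).
by rewrite scalerA mulVf// scale1r ler_pdivlMl.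
Qed.

Lemma tilt_ge q a x m :
  (forall t, 0 <= t -> m <= q (x + t *: a) - t * q a) -> m <= tilt q a x.
Proof.
move=> mle; apply: lb_le_inf; first by exists (q (x + 0 *: a) - 0 * q a), 0 => /=.
by move=> _ [t /= t0 <-]; exact: mle.
Qed.

Lemma sublinear_tilt q a : sublinear q -> sublinear (tilt q a).
Proof.
move=> qS; have [qD qZ] := qS; split=> [x y|c x c0].
  rewrite -lerBlDl; apply: tilt_ge => t t0.
  rewrite lerBlDl -lerBlDr; apply: tilt_ge => s s0.
  rewrite lerBlDr (le_trans (tilt_le _ _ _ (addr_ge0 s0 t0)))//.
  by rewrite scalerDl addrACA mulrDl opprD [leRHS]addrACA lerD2r.
have H t : 0 <= t -> tilt q a (c *: x) <= c * (q (x + t *: a) - t * q a).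
  move=> t0; rewrite (le_trans (tilt_le _ _ _ (mulr_ge0 c0 t0)))//.
  by rewrite mulrBr -mulrA lerD2r -scalerA -scalerDr qZ.
have [cE0|cN0] := eqVneq c 0.
  by have := H 0 (lexx _); rewrite cE0 !mul0r.
have cgt0 : 0 < c by rewrite lt_neqAle eq_sym cN0.
by rewrite -ler_pdivrMl//; apply: tilt_ge => t t0; rewrite ler_pdivrMl// H.
Qed.

Lemma tilt_le_self q a x : sublinear q -> tilt q a x <= q x.
Proof.
by move=> qS; have := tilt_le a x qS (lexx _); rewrite scale0r mul0r subr0 addr0.
Qed.

Lemma tiltN q a : sublinear q -> tilt q a (- a) <= - q a.
Proof.
move=> qS; have := tilt_le a (- a) qS ler01.
by rewrite scale1r mul1r addNr (sublinear0 qS) sub0r.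
Qed.

Lemma sublinear_odd_linear q :
  sublinear q -> (forall a, q (- a) <= - q a) -> scalar q.
Proof.
move=> qS qN; have [qD qZ] := qS.
have qNE a : q (- a) = - q a.
  by apply/le_anti; rewrite qN lerNl sublinear_ge.
have qDE x y : q (x + y) = q x + q y.
  apply/le_anti; rewrite qD/= -lerN2 opprD -!qNE opprD; exact: qD.
have qZp c x : 0 <= c -> q (c *: x) = c * q x.
  move=> c0; apply/le_anti; rewrite qZ//= -lerN2 -qNE -scalerN -mulrN -qNE.
  exact: qZ.
move=> c x y; rewrite qDE; congr (_ + _).
have [/qZp->//|c0] := leP 0 c.
rewrite -[c in LHS]opprK scaleNr qNE qZp ?mulNr ?opprK//.
by rewrite oppr_ge0 ltW.
Qed.

(** Zorn's lemma applies because a chain of sublinear functionals below [p] is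
    bounded below pointwise by [- p (- x)], so that its infimum is finite. *)
Lemma minimal_sublinear p : sublinear p ->
  exists q, [/\ sublinear q, forall x, q x <= p x &
    forall q', sublinear q' -> (forall x, q' x <= q x) -> forall x, q x <= q' x].
Proof.
move=> pS.
pose T := {q : V -> R | sublinear q /\ forall x, q x <= p x}.
pose below (s t : T) := `[< forall x, sval t x <= sval s x >].
have [||A Atot|[q [qS qp]] qmin] := @ZL_preorder T (exist _ p (conj pS (fun=> lexx _))) below.
- by move=> t; apply/asboolP.
- move=> r s t /asboolP rs /asboolP st; apply/asboolP => x.
  exact: le_trans (st x) (rs x).
- have [A0|/set0P[s0 As0]] := eqVneq A set0.
    by exists (exist _ p (conj pS (fun=> lexx _))) => s; rewrite A0.
  pose m x := inf [set sval s x | s in A].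
  have mle s x : A s -> m x <= sval s x.
    move=> As; apply: ge_inf; last by exists s.
    exists (- p (- x)) => _ [[r [rS rp]] /= _ <-].
    by rewrite (le_trans _ (sublinear_ge _ rS))// lerN2.
  have mge x b : (forall s, A s -> b <= sval s x) -> b <= m x.
    move=> ble; apply: lb_le_inf; first by exists (sval s0 x), s0.
    by move=> _ [s As <-]; exact: ble.
  have mS : sublinear m.
    split=> [x y|c x c0].
      rewrite -lerBlDl; apply: (mge) => t At.
      rewrite lerBlDl -lerBlDr; apply: (mge) => s As.
      rewrite lerBlDr; have [/asboolP st|/asboolP ts] := Atot _ _ As At.
        rewrite (le_trans (mle t _ At))// (le_trans ((svalP t).1.1 _ _))//.
        by rewrite lerD2r.
      rewrite (le_trans (mle s _ As))// (le_trans ((svalP s).1.1 _ _))//.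
      by rewrite lerD2l.
    have H s : A s -> m (c *: x) <= c * sval s x.
      by move=> As; rewrite (le_trans (mle s _ As))// (svalP s).1.2.
    have [cE0|cN0] := eqVneq c 0.
      by have := H s0 As0; rewrite cE0 !mul0r.
    have cgt0 : 0 < c by rewrite lt_neqAle eq_sym cN0.
    by rewrite -ler_pdivrMl//; apply: (mge) => s As; rewrite ler_pdivrMl// H.
  have mp x : m x <= p x by rewrite (le_trans (mle s0 _ As0))// (svalP s0).2.
  by exists (exist _ m (conj mS mp)) => s As; apply/asboolP => x; exact: mle.
exists q; split=> // q' q'S q'q.
have q'p x : q' x <= p x by exact: le_trans (q'q x) (qp x).
have /asboolP := qmin (exist _ q' (conj q'S q'p)) (introT (asboolP _) q'q).
exact.
Qed.

(** A minimal sublinear functional coincides with all its tilts, hence is odd,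
    hence linear; taking it below the tilt of [p] along [y] forces the value
    at [y]. *)
Theorem HahnBanach p y : sublinear p ->
  exists u : V -> R, [/\ scalar u, forall x, u x <= p x & u y = p y].
Proof.
move=> pS.
have [q [qS qp qmin]] := minimal_sublinear (sublinear_tilt y pS).
have qN a : q (- a) <= - q a.
  apply: le_trans (tiltN a qS).
  by apply: qmin => [|x]; [exact: sublinear_tilt|exact: tilt_le_self].
have qL := sublinear_odd_linear qS qN.
have qlep x : q x <= p x by rewrite (le_trans (qp x))// tilt_le_self.
exists q; split=> //; apply/le_anti; rewrite qlep/=.
rewrite -lerN2 (le_trans _ (tiltN y pS))// (le_trans _ (qp _))//.
by rewrite lerNl sublinear_ge.
Qed.

End HahnBanach.

(** * Decompositions along two closed subspaces *)

Section Subspaces.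
Variables (K : numFieldType) (X : normedModType K).
Implicit Types (N M : set X).

Lemma subspaceP N : subspace N <->
  N 0 /\ forall (c : K) x y, N x -> N y -> N (c *: x + y).
Proof.
split=> [[N0 NS]|[N0 NS]]; split.
- exact: set_mem.
- by move=> c x y Nx Ny; apply: set_mem; apply: NS; exact: mem_set.
- exact: mem_set.
- by move=> c x y /set_mem Nx /set_mem Ny; apply: mem_set; exact: NS.
Qed.

Lemma subspace0 N : subspace N -> N 0.
Proof. by move=> /subspaceP[]. Qed.

Lemma subspaceD N x y : subspace N -> N x -> N y -> N (x + y).
Proof. by move=> /subspaceP[_ NS] Nx Ny; rewrite -[x]scale1r; exact: NS. Qed.

Lemma subspaceZ N (c : K) x : subspace N -> N x -> N (c *: x).
Proof. by move=> /subspaceP[N0 NS] Nx; rewrite -[_ *: _]addr0; exact: NS. Qed.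

Lemma subspaceB N x y : subspace N -> N x -> N y -> N (x - y).
Proof. by move=> NS Nx Ny; rewrite -scaleN1r; apply: subspaceD => //; exact: subspaceZ. Qed.

Lemma closure_distP (A : set X) x :
  closure A x <-> forall e : K, 0 < e -> exists2 y, A y & `|x - y| < e.
Proof.
split=> [clAx e e0|clA B /nbhs_ballP[e e0 eB]].
  have [y [Ay xey]] := clAx _ (nbhsx_ballx x e e0).
  by exists y => //; move: xey; rewrite -ball_normE.
by have [y Ay xye] := clA e e0; exists y; split=> //; apply: eB; rewrite -ball_normE.
Qed.

End Subspaces.

Section BoundedDecomposition.
Variables (R : realType) (X : completeNormedModType R) (N M : set X).
Hypotheses (NS : subspace N) (MS : subspace M).

Let sums (b : R) : set X :=
  [set z | exists x y, [/\ N x, M y, `|x| <= b, `|y| <= b & z = x + y]].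

(** Baire's theorem applies because the sets [sums n] cover the space.  It gives
    a ball around some [x0]; subtracting approximations of [x0] moves the ball
    to the origin at the cost of doubling the bound. *)
Lemma closure_sums_ball : [set x + y | x in N & y in M] = setT ->
  exists2 b : R, 0 <= b & exists2 r : R, 0 < r & ball 0 r `<=` closure (sums b).
Proof.
move=> NMT.
pose F n : set X := ~` closure (sums n%:R).
have [n nd] : exists n, ~ dense (F n).
  apply/not_existsP => /= Fd.
  have /Baire : forall n, open (F n) /\ dense (F n).
    move=> n; split; first exact/closed_openC/closed_closure.
    exact: contrapT (Fd n).
  move=> /(_ setT (ex_intro _ 0 I) openT)[z [_ zF]].
  have [x Nx [y My xyz]] : [set x + y | x in N & y in M] z by rewrite NMT.
  pose n := Num.truncn (Num.max `|x| `|y|).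
  apply: (zF n.+1 I); apply: subset_closure; exists x, y.
  have maxn : Num.max `|x| `|y| <= n.+1%:R by rewrite ltW// truncnS_gt.
  by split=> //; rewrite (le_trans _ maxn)// le_max lexx ?orbT.
have [O [[x0 /open_nbhs_nbhs/nbhs_ballP[r r0 rO]] OF]] := denseNE nd.
have rF : ball x0 r `<=` closure (sums n%:R).
  move=> x /rO Ox; apply: contrapT => xF.
  by have : (O `&` F n) x by []; rewrite OF.
exists (n%:R + n%:R); first by rewrite addr_ge0.
exists r => // z.
rewrite -ball_normE /= sub0r normrN => zr.
apply/closure_distP => e e0.
have e20 : 0 < e / 2 by rewrite divr_gt0.
have /closure_distP/(_ _ e20)[_ [x [y [Nx My xn yn ->]]] xye] :
    closure (sums n%:R) (x0 + z).
  by apply: rF; rewrite -ball_normE /= opprD addrA subrr sub0r normrN.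
have /closure_distP/(_ _ e20)[_ [x' [y' [Nx' My' xn' yn' ->]]] xye'] :
    closure (sums n%:R) x0 by apply: rF; exact: ballxx.
exists ((x - x') + (y - y')).
  exists (x - x'), (y - y'); split=> //; [exact: subspaceB|exact: subspaceB| |].
    by rewrite (le_trans (ler_normB _ _))// lerD.
  by rewrite (le_trans (ler_normB _ _))// lerD.
rewrite [e]splitr.
have -> : z - (x - x' + (y - y')) = (x0 + z - (x + y)) - (x0 - (x' + y')).
  rewrite [x - x' + _]addrACA -opprD opprB [in RHS]addrC opprB -[x0 + z - _]addrA.
  by rewrite subrKA addrCA.
by rewrite (le_lt_trans (ler_normB _ _))// ltrD.
Qed.

(** One step of the successive approximation below: the ball of the previous
    lemma is rescaled to the size of [z]. *)
Lemma halving_sums : [set x + y | x in N & y in M] = setT ->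
  exists2 b : R, 0 <= b & forall z, exists x y,
    [/\ N x, M y, `|x| <= b * `|z| & `|z - (x + y)| <= `|z| / 2].
Proof.
move=> /closure_sums_ball[b b0 [r r0 rb]].
exists (b * (2 / r)) => [|z]; first by rewrite mulr_ge0// divr_ge0// ltW.
have [->|z0] := eqVneq z 0.
  exists 0, 0; split; [exact: subspace0|exact: subspace0| |].
    by rewrite !normr0 mulr0.
  by rewrite addr0 subr0 normr0 mul0r.
have nz0 : 0 < `|z| by rewrite normr_gt0.
(* [c *: z] has norm [r / 2], inside the ball of radius [r]. *)
pose c := r / 2 / `|z|.
have c0 : 0 < c by rewrite !divr_gt0.
have cE : c^-1 = 2 / r * `|z| by rewrite /c !invfM !invrK [r^-1 * _]mulrC.
have /rb/closure_distP/(_ (r / 4))[|_ [x [y [Nx My xb _ ->]]] xyr] : ball 0 r (c *: z).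
- rewrite -ball_normE /= sub0r normrN normrZ gtr0_norm// divfK ?gt_eqF//.
  by rewrite ltr_pdivrMr// ltr_pMr// ltr1n.
- by rewrite divr_gt0.
exists (c^-1 *: x), (c^-1 *: y); split; [exact: subspaceZ|exact: subspaceZ| |].
  rewrite normrZ gtr0_norm ?invr_gt0// cE mulrC -[leRHS]mulrA.
  by rewrite ler_wpM2r// mulr_ge0// divr_ge0// ltW.
rewrite -scalerDr -[z in `|z - _|](scalerK (lt0r_neq0 c0)) -scalerBr normrZ.
rewrite gtr0_norm ?invr_gt0// ler_pdivrMl// (le_trans (ltW xyr))//.
have z0' : `|z| != 0 by rewrite gt_eqF.
by have -> : c * (`|z| / 2) = r / 4 by rewrite /c; field.
Qed.

(** The open mapping theorem for the addition map from [N x M] to the space: as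
    each step halves the remainder, the approximations sum to an exact
    decomposition with control of the norm. *)
Lemma bounded_decomposition : closed N -> closed M ->
  [set x + y | x in N & y in M] = setT ->
  exists2 C : R, 0 <= C & forall z, exists x y,
    [/\ N x, M y, z = x + y & `|x| <= C * `|z|].
Proof.
move=> Ncl Mcl /halving_sums[b b0 /choice[f fP]].
have [g gP] := choice fP.
exists (b * 2) => [|z]; first exact: mulr_ge0.
(* [s n] is what remains of [z] after [n] approximations. *)
pose s := fix s n := if n is k.+1 then s k - (f (s k) + g (s k)) else z.
have s_le n : `|s n| <= `|z| / 2 ^+ n.
  elim: n => [|n IH]; first by rewrite expr0 divr1.
  have [_ _ _ /le_trans->//] := gP (s n).
  by rewrite exprSr invfM mulrA ler_wpM2r ?invr_ge0.
pose x := series (f \o s).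
have x0 : x 0%N = 0 by rewrite /x /series /= big_geq.
have xS n : x n.+1 = x n + f (s n) by rewrite /x seriesSr.
have Nx n : N (x n).
  elim: n => [|n IH]; first by rewrite x0; exact: subspace0.
  by rewrite xS; apply: subspaceD => //; have [] := gP (s n).
have My n : M (z - s n - x n).
  elim: n => [|n IH]; first by rewrite x0 /= subrr subr0; exact: subspace0.
  have -> : z - s n.+1 - x n.+1 = z - s n - x n + g (s n).
    rewrite xS /= opprD opprK [f _ + _]addrC [x n + _]addrC opprD !addrA.
    by rewrite addrK addrAC.
  by apply: subspaceD => //; have [] := gP (s n).
have x_le n : `|x n| <= b * 2 * `|z| * (1 - (2 ^+ n)^-1).
  elim: n => [|n IH]; first by rewrite x0 normr0 expr0 invr1 subrr mulr0.
  rewrite xS (le_trans (ler_normD _ _))//.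
  have [_ _ fb _] := gP (s n).
  rewrite (le_trans (lerD IH (le_trans fb (ler_wpM2l b0 (s_le n)))))//.
  have p2 : 2 ^+ n != 0 :> R by rewrite expf_neq0 ?pnatr_eq0.
  by rewrite exprS le_eqVlt; apply/orP; left; apply/eqP; field.
have h1 : `|2^-1 : R| < 1 by rewrite gtr0_norm ?invr_gt0// invf_lt1 ?ltr1n.
have : cvgn x.
  apply: normed_cvg.
  apply: (@series_le_cvg _ _ (geometric (b * `|z|) 2^-1)) => [n|n|n|] /=.
  - exact: normr_ge0.
  - by rewrite !mulr_ge0// exprn_ge0 ?invr_ge0.
  - have [_ _ fb _] := gP (s n).
    by rewrite (le_trans fb)// -mulrA exprVn ler_wpM2l.
  - exact: is_cvg_geometric_series.
move=> /cvg_ex[/= l xl].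
have s0 : s n @[n --> \oo] --> 0.
  apply: norm_cvg0; apply: squeeze_cvgr (cvg_cst 0) (cvg_geometric `|z| h1).
  by apply: nearW => n /=; rewrite normr_ge0 exprVn s_le.
exists l, (z - l); split.
- by apply: closed_cvg xl => //; exact: nearW.
- have zsx : z - s n - x n @[n --> \oo] --> z - 0 - l.
    by apply: cvgB xl; apply: cvgB s0; exact: cvg_cst.
  by rewrite -[z]subr0; apply: closed_cvg zsx => //; exact: nearW.
- by rewrite addrC subrK.
- apply: cvgr_to_le (cvg_norm xl) _; apply: nearW => n.
  rewrite (le_trans (x_le n))// ler_piMr ?mulr_ge0//.
  by rewrite gerBl invr_ge0 exprn_ge0.
Qed.

End BoundedDecomposition.

(** * Complex Banach spaces as real Banach spaces *)

Section Realified.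
Local Open Scope complex_scope.
Variables (R : realType) (X : completeNormedModType R[i]).

(** A copy of [X] that carries the scalars and the norm of a real Banach space;
    the two norms differ only by the embedding of [R] into [R[i]], so that the
    topologies agree. *)
Definition realified : Type := X.

HB.instance Definition _ := GRing.Zmodule.copy realified X.

Definition real_scale (r : R) (x : realified) : realified := r%:C *: (x : X).

Let real_scaleA a b x : real_scale a (real_scale b x) = real_scale (a * b) x.
Proof. by rewrite /real_scale scalerA rmorphM. Qed.
Let real_scale1 : left_id 1 real_scale.
Proof. by move=> x; rewrite /real_scale rmorph1 scale1r. Qed.
Let real_scaleDr : right_distributive real_scale +%R.
Proof. by move=> a x y; rewrite /real_scale scalerDr. Qed.
Let real_scaleDl x : {morph real_scale^~ x : a b / a + b}.
Proof. by move=> a b; rewrite /real_scale rmorphD scalerDl. Qed.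

HB.instance Definition _ := GRing.Zmodule_isLmodule.Build R realified
  real_scaleA real_scale1 real_scaleDr real_scaleDl.

Definition real_norm (x : realified) : R := complex.Re `|x : X|.

Lemma real_normE (x : X) : `|x| = (real_norm x)%:C.
Proof. by rewrite /real_norm RRe_real// normr_real. Qed.

Let real_normD x y : real_norm (x + y) <= real_norm x + real_norm y.
Proof. by rewrite -lecR rmorphD /= -!real_normE ler_normD. Qed.
Let real_normZ (l : R) x : real_norm (l *: x) = `|l| * real_norm x.
Proof.
apply: (@complexI R); rewrite rmorphM /= -!real_normE normrZ; congr (_ * _).
by rewrite normc_def /= expr0n addr0 sqrtr_sqr.
Qed.
Let real_norm0_eq0 x : real_norm x = 0 -> x = 0.
Proof. by move=> x0; apply/normr0_eq0; rewrite real_normE x0. Qed.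

HB.instance Definition _ := Lmodule_isNormed.Build R realified
  real_normD real_normZ real_norm0_eq0.

Lemma realified_normE (x : X) : `|x| = (`|x : realified|)%:C.
Proof. exact: real_normE. Qed.

Lemma gt0_complex (e : R[i]) : 0 < e -> exists2 r : R, 0 < r & e = r%:C.
Proof.
move=> e0; exists (complex.Re e); last by rewrite RRe_real// gtr0_real.
by rewrite -ltcR RRe_real// gtr0_real.
Qed.

Let realified_complete (F : set_system realified) :
  ProperFilter F -> cauchy F -> cvg F.
Proof.
move=> FF Fc.
have : @cauchy X F.
  apply/cauchy_ballP => _ /gt0_complex[r r0 ->].
  have /cauchy_ballP/(_ r r0) := Fc.
  apply: filterS => -[x y] /=.
  by rewrite -!ball_normE /= realified_normE ltcR.
move=> /cauchy_cvg/cvg_ex[/= l Fl].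
apply/cvg_ex; exists (l : realified); apply/fcvg_ballP => r r0.
have r0' : 0 < r%:C by rewrite ltcR.
have /fcvg_ballP/(_ _ r0') := Fl.
apply: filterS => x /=.
by rewrite -!ball_normE /= realified_normE ltcR.
Qed.

HB.instance Definition _ := Uniform_isComplete.Build realified
  realified_complete.

Lemma realified_closed (N : set X) : closed N -> closed (N : set realified).
Proof.
move=> Ncl x /closure_distP clx; apply: Ncl; apply/closure_distP.
move=> _ /gt0_complex[r r0 ->]; have [y Ny xyr] := clx r r0.
by exists y => //; rewrite realified_normE ltcR.
Qed.

Lemma realified_subspace (N : set X) : subspace N -> subspace (N : set realified).
Proof.
move=> NS; apply/subspaceP; split; first exact: (subspace0 NS).
by move=> c x y; apply: ((subspaceP _).1 NS).2.
Qed.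

End Realified.

(** * Separating functionals and projections over both scalar fields *)

Definition bounded_functional (K : numFieldType) (X : normedModType K)
    (f : X -> K) : Prop :=
  scalar f /\ exists2 C : K, 0 <= C & forall x, `|f x| <= C * `|x|.

(** The Hahn-Banach theorem for the distance to [N], which is sublinear, zero on
    [N], and positive at [y] because [N] is closed. *)
Lemma distance_functional (R : realType) (X : normedModType R) (N : set X) y :
  closed_subspace N -> ~ N y -> exists u : X -> R,
    [/\ scalar u, forall x, `|u x| <= `|x|, forall x, N x -> u x = 0 & u y != 0].
Proof.
move=> [NS Ncl] Ny.
have N0 := subspace0 NS.
pose p x := inf [set `|x - n| | n in N].
have p_le x n : N n -> p x <= `|x - n|.
  move=> Nn; apply: ge_inf; last by exists n.
  by exists 0 => _ [m _ <-].
have p_ge x b : (forall n, N n -> b <= `|x - n|) -> b <= p x.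
  move=> ble; apply: lb_le_inf; first by exists `|x - 0|, 0.
  by move=> _ [n Nn <-]; exact: ble.
have pS : sublinear p.
  split=> [x x'|c x c0].
    rewrite -lerBlDl; apply: (p_ge) => n Nn.
    rewrite lerBlDl -lerBlDr; apply: (p_ge) => m Nm.
    rewrite lerBlDr (le_trans (p_le _ _ (subspaceD NS Nm Nn)))//.
    by rewrite opprD addrACA ler_normD.
  have H n : N n -> p (c *: x) <= c * `|x - n|.
    move=> Nn; rewrite (le_trans (p_le _ _ (subspaceZ c NS Nn)))//.
    by rewrite -scalerBr normrZ ger0_norm.
  have [cE0|cN0] := eqVneq c 0.
    by have := H 0 N0; rewrite cE0 !mul0r.
  have cgt0 : 0 < c by rewrite lt_neqAle eq_sym cN0.
  by rewrite -ler_pdivrMl//; apply: (p_ge) => n Nn; rewrite ler_pdivrMl// H.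
have [u [uL up uy]] := HahnBanach y pS.
have uN x : u (- x) = - u x by exact: functionalN.
have u_le x : u x <= `|x|.
  by rewrite (le_trans (up x))// (le_trans (p_le x 0 N0))// subr0.
exists u; split=> //.
- by move=> x; rewrite ler_norml u_le andbT lerNl -uN -[leRHS]normrN u_le.
- have uNle x : N x -> u x <= 0.
    by move=> Nx; rewrite (le_trans (up x))// (le_trans (p_le x x Nx))// subrr normr0.
  move=> x Nx; apply/le_anti; rewrite uNle//= -oppr_le0 -uN uNle//.
  by rewrite -scaleN1r; exact: subspaceZ.
- rewrite uy gt_eqF//.
  have /existsNP[e /not_implyP[e0 He]] :
      ~ forall e : R, 0 < e -> exists2 n, N n & `|y - n| < e.
    by move=> /closure_distP clNy; apply: Ny; exact: Ncl.
  apply: (lt_le_trans e0); apply: (p_ge) => n Nn.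
  by rewrite leNgt; apply/negP => yne; apply: He; exists n.
Qed.

Section Complexification.
Local Open Scope complex_scope.
Variables (R : realType) (X : completeNormedModType R[i]).

(** [u x - i * u (i x)] is the complex linear functional whose real part is
    [u]. *)
Lemma complex_functional (u : realified X -> R) :
  scalar u -> (forall x, `|u x| <= `|x|) ->
  bounded_functional (fun x : X => Complex (u x) (- u ('i%C *: x))).
Proof.
move=> uL u_le.
have uZ (r : R) (x : X) : u (r%:C *: x) = r * u x by exact: (functionalZ uL).
have uD (x y : X) : u (x + y) = u x + u y by exact: (functionalD uL).
split=> [c x y|].
  case: c => a b.
  have cE (z : X) : Complex a b *: z = a%:C *: z + b%:C *: ('i%C *: z).
    rewrite scalerA -scalerDl; congr (_ *: _).
    by rewrite [LHS]complexE /= [b%:C * _]mulrC.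
  have ii (z : X) : 'i%C *: ('i%C *: z) = (-1)%:C *: z.
    by rewrite scalerA -expr2 sqr_i rmorphN1.
  rewrite scalerDr cE scalerDr !(scalerA 'i%C) ![_ * _%:C]mulrC -!scalerA ii.
  rewrite !uD !uZ.
  by congr Complex => /=; ring.
exists 2%:R => // x.
rewrite realified_normE [Complex _ _]complexE.
rewrite (le_trans (ler_normD _ _))// normrM.
have nr (r : R) : `|r%:C| = `|r|%:C.
  by rewrite normc_def /= expr0n addr0 sqrtr_sqr.
have ni : `|'i%C : R[i]| = 1 by rewrite normc_def /= expr0n add0r expr1n sqrtr1.
rewrite ni mul1r !nr normrN -rmorphD /= mulr_natl -rmorphMn lecR mulr2n lerD//.
rewrite (le_trans (u_le _))// -lecR -!realified_normE.
by rewrite normrZ ni mul1r.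
Qed.

End Complexification.

Section Banach.
Variables (R : realType) (is_complex : bool).
Variable (X : completeNormedModType (scalars R is_complex)).
Local Notation K := (scalars R is_complex).
Implicit Types (N M : set X).

Lemma separating_functional N y : closed_subspace N -> ~ N y ->
  exists f : X -> K,
    [/\ bounded_functional f, forall x, N x -> f x = 0 & f y = 1].
Proof.
move=> NS Ny.
suff [f [[fL [C C0 fC]] fN fy]] : exists f : X -> K,
    [/\ bounded_functional f, forall x, N x -> f x = 0 & f y != 0].
  exists (fun x => f x / f y); split; last by rewrite divff.
  - split=> [a x x'|]; first by rewrite fL mulrDl mulrA.
    exists (C * `|f y|^-1) => [|x]; first by rewrite mulr_ge0 ?invr_ge0.
    by rewrite normrM normfV mulrAC ler_wpM2r ?invr_ge0.
  - by move=> x /fN ->; rewrite mul0r.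
case: is_complex X N y NS Ny => X' N y NS Ny.
- have [NS' Ncl] := NS.
  have NS'' : closed_subspace (N : set (realified X')).
    by split; [exact: realified_subspace|exact: realified_closed].
  have [u [uL u_le uN uy]] := distance_functional NS'' Ny.
  exists (fun x => Complex (u x) (- u ('i%C *: x))); split.
  + exact: complex_functional.
  + move=> x Nx; rewrite !uN ?oppr0//.
    exact: (subspaceZ 'i%C NS').
  + by apply: contra_neq uy => -[].
- have [u [uL u_le uN uy]] := distance_functional NS Ny.
  exists u; split=> //; split=> //.
  by exists 1 => // x; rewrite mul1r.
Qed.

(** The decompositions of bounded norm are the only ones, since [N] and its
    complement meet in [0]; hence they depend linearly on the vector. *)
Lemma bounded_projection N : closed_subspace N -> complemented N ->
  exists e : X -> X,
    [/\ bounded_operator e, forall x, N (e x) & forall x, N x -> e x = x].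
Proof.
move=> [NS Ncl] [M [[MS Mcl] NM NMT]].
have : exists2 C : K, 0 <= C & forall z, exists x y,
    [/\ N x, M y, z = x + y & `|x| <= C * `|z|].
  case: is_complex X N M NS Ncl MS Mcl NM NMT => X' N M NS Ncl MS Mcl NM NMT.
    have [C C0 CP] := bounded_decomposition (realified_subspace NS)
      (realified_subspace MS) (realified_closed Ncl) (realified_closed Mcl) NMT.
    exists C%:C%C; first by rewrite lecR.
    move=> z; have [x [y [Nx My zxy xC]]] := CP z.
    exists x, y; split=> //.
    by rewrite !realified_normE -rmorphM lecR.
  exact: bounded_decomposition.
move=> [C C0 /choice[e eP]].
have eM x : M (x - e x).
  by have [y [_ My xE _]] := eP x; rewrite {1}xE addrAC subrr add0r.
have uniq x y : N x -> M (y - x) -> e y = x.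
  move=> Nx Myx; apply/eqP; rewrite -subr_eq0; apply/eqP.
  have [? [Ney _ _ _]] := eP y.
  have : (N `&` M) (e y - x).
    split; first exact: subspaceB.
    have -> : e y - x = (y - x) - (y - e y) by rewrite opprB [RHS]addrC subrKA.
    exact: subspaceB.
  by rewrite NM.
exists e; split.
- split=> [a x y|]; last by exists C => // x; have [? []] := eP x.
  have [? [Nex _ _ _]] := eP x; have [? [Ney _ _ _]] := eP y.
  apply: uniq; first by apply: subspaceD => //; exact: subspaceZ.
  by rewrite opprD addrACA -scalerBr; apply: subspaceD => //; exact: subspaceZ.
- by move=> x; have [? []] := eP x.
- by move=> x Nx; apply: uniq => //; rewrite subrr; exact: subspace0.
Qed.

End Banach.

(** * Local multiplication at idempotents *)

Section IdempotentMultiplier.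
Variables (A : pzRingType) (psi : {additive A -> A}).

(** [psi (e * b)] lies in [e * A] and [psi (b - e * b)] in [(1 - e) * A], so
    they are the two components of [psi b]. *)
Lemma local_right_idempotentM (e : A) :
  (forall a, exists b, psi a = a * b) -> e * e = e ->
  forall b, psi (e * b) = e * psi b.
Proof.
move=> psiP ee b.
have [c ec] := psiP (e * b).
have [d ed] := psiP (b - e * b).
have : e * psi (b - e * b) = 0.
  by rewrite ed mulrA mulrBr mulrA ee subrr mul0r.
rewrite raddfB mulrBr => /eqP; rewrite subr_eq0 => /eqP ->.
by rewrite ec !mulrA ee.
Qed.

Lemma local_left_idempotentM (e : A) :
  (forall a, exists b, psi a = b * a) -> e * e = e ->
  forall b, psi (b * e) = psi b * e.
Proof.
move=> psiP ee b.
have [c ec] := psiP (b * e).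
have [d ed] := psiP (b - b * e).
have : psi (b - b * e) * e = 0.
  by rewrite ed -mulrA mulrBl -mulrA ee subrr mulr0.
rewrite raddfB mulrBl => /eqP; rewrite subr_eq0 => /eqP ->.
by rewrite ec -!mulrA ee.
Qed.

End IdempotentMultiplier.

(** * Rank one operators in a nest algebra *)

Section NestAlgebra.
Variables (K : numFieldType) (X : normedModType K) (NN : nest X).
Local Notation A := (Alg NN).
Implicit Types (N M : set X) (s t e : A) (f g : X -> K).

Lemma alg_ext s t : (forall x, s x = t x) -> s = t.
Proof. by move=> st; apply: val_inj; apply/funext. Qed.

Lemma alg_linear t : linear t.
Proof. by case: t => t /= /set_mem[[]]. Qed.

Lemma alg_bounded t : exists2 C : K, 0 <= C & forall x, `|t x| <= C * `|x|.
Proof. by case: t => t /= /set_mem[[]]. Qed.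

Lemma alg_invariant t N x : NN N -> N x -> N (t x).
Proof. by case: t => t /= /set_mem[_ tN] NNN Nx; apply: (tN N NNN); exists x. Qed.

Lemma alg_mulE s t x : (s * t) x = s (t x). Proof. by []. Qed.
Lemma alg_subE s t x : (s - t) x = s x - t x. Proof. by []. Qed.
Lemma alg_addE s t x : (s + t) x = s x + t x. Proof. by []. Qed.
Lemma alg_scaleE (c : K) t x : (c *: t) x = c *: t x. Proof. by []. Qed.

Lemma alg_scalerAl (c : K) s t : c *: (s * t) = (c *: s) * t.
Proof. exact: alg_ext. Qed.

Lemma alg0 t : t 0 = 0.
Proof. by have := alg_linear t (-1) 0 0; rewrite scaler0 addr0 scaleN1r addNr. Qed.

Lemma algZ t (c : K) x : t (c *: x) = c *: t x.
Proof. by have := alg_linear t c x 0; rewrite addr0 alg0 addr0. Qed.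

Lemma algD t x y : t (x + y) = t x + t y.
Proof. by have := alg_linear t 1 x y; rewrite !scale1r. Qed.

Lemma algB t x y : t (x - y) = t x - t y.
Proof. by rewrite algD -scaleN1r algZ scaleN1r. Qed.

Lemma alg_scalerAr (c : K) s t : c *: (s * t) = s * (c *: t).
Proof. by apply: alg_ext => x; rewrite alg_scaleE !alg_mulE alg_scaleE algZ. Qed.

Lemma bounded_functionalD f g : bounded_functional f -> bounded_functional g ->
  bounded_functional (fun x => f x + g x).
Proof.
move=> [fL [C C0 fC]] [gL [D D0 gD]]; split=> [a x y|].
  by rewrite fL gL mulrDr addrACA.
exists (C + D) => [|x]; first exact: addr_ge0.
by rewrite (le_trans (ler_normD _ _))// mulrDl lerD.
Qed.

Lemma bounded_functionalN f : bounded_functional f ->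
  bounded_functional (fun x => - f x).
Proof.
move=> [fL [C C0 fC]]; split=> [a x y|].
  by rewrite fL opprD mulrN.
by exists C => // x; rewrite normrN.
Qed.

(** ** The predecessor of an element of a nest *)

Lemma nest_subspace N : NN N -> subspace N.
Proof. by move=> /(nest_closed_subspace (nestP NN))[]. Qed.

Lemma closed_span_sub (B N : set X) : closed_subspace N -> B `<=` N ->
  closed_span B `<=` N.
Proof.
move=> [NS Ncl] BN; rewrite (closure_id N).1//.
by apply: closure_subset; exact: smallest_sub.
Qed.

Lemma nest_pred_in N : NN (nest_pred NN N).
Proof. by apply: (nest_bigjoin (nestP NN)) => M []. Qed.

Lemma nest_pred_sub N : NN N -> nest_pred NN N `<=` N.
Proof.
move=> NNN; apply: closed_span_sub; first exact: nest_closed_subspace (nestP NN) _ NNN.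
by move=> x [M [_ [MN _]]] /MN.
Qed.

Lemma sub_nest_pred N M : NN M -> M `<` N -> M `<=` nest_pred NN N.
Proof.
move=> NNM MN x Mx; apply: subset_closure; apply: sub_gen_smallest.
by exists M.
Qed.

Lemma nest_pred_or N M : NN N -> NN M -> M `<=` nest_pred NN N \/ N `<=` M.
Proof.
move=> NNN NNM; have [MN|NM] := nest_chain (nestP NN) NNM NNN; last by right.
have [NM|NM] := pselect (N `<=` M); first by right.
by left; exact: sub_nest_pred.
Qed.

(** ** Rank one operators *)

Definition rank_one (z : X) (f : X -> K) (x : X) : X := f x *: z.

Definition pred_annihilator N f : Prop :=
  bounded_functional f /\ forall x, nest_pred NN N x -> f x = 0.

(** A member [M] of the nest is invariant because the operator vanishes on it
    when [M] lies in [N_-], and has its range inside it otherwise, as [M] then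
    contains [N]. *)
Lemma rank_one_in N z f : NN N -> N z -> pred_annihilator N f ->
  exists t, forall x, t x = f x *: z.
Proof.
move=> NNN Nz [[fL [C C0 fC]] fN].
suff tP : rank_one z f \in nest_operators NN by exists (MkAlg tP).
apply: mem_set; split=> [|M NNM _ [x Mx <-]].
  split=> [a x y|]; first by rewrite /rank_one fL scalerDl scalerA.
  exists (C * `|z|) => [|x]; first exact: mulr_ge0.
  by rewrite normrZ mulrAC ler_wpM2r.
rewrite /rank_one; have [MN|NM] := nest_pred_or NNN NNM.
  by rewrite fN ?scale0r; [exact: subspace0 (nest_subspace NNM)|exact: MN].
by apply: subspaceZ; [exact: nest_subspace|exact: NM].
Qed.

(** The projection fixes pointwise a member of the nest inside [N], and has its
    range inside one that contains [N]. *)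
Lemma projection_in N (p : X -> X) : NN N -> bounded_operator p ->
  (forall x, N (p x)) -> (forall x, N x -> p x = x) -> p \in nest_operators NN.
Proof.
move=> NNN pB pN pid; apply: mem_set; split=> // M NNM _ [x Mx <-].
have [MN|NM] := nest_chain (nestP NN) NNM NNN; last exact: NM.
by rewrite pid//; exact: MN.
Qed.

(** ** Linear combinations of idempotents *)

Section IdempotentSpan.
(* The span of the idempotents is used through its universal property: [S] stands
   for any subspace that contains them. *)
Variable S : set A.
Hypothesis SB : forall s t, S s -> S t -> S (s - t).
Hypothesis SZ : forall (c : K) s, S s -> S (c *: s).
Hypothesis Sidem : forall e, e * e = e -> S e.

Let SD s t : S s -> S t -> S (s + t).
Proof.
by move=> Ss St; rewrite -[t]opprK; apply: SB => //; rewrite -scaleN1r; exact: SZ.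
Qed.

Lemma rank_one_nonzero_trace z f t : bounded_functional f ->
  (forall x, t x = f x *: z) -> f z != 0 -> S t.
Proof.
move=> [fL _] tE fz0; rewrite -[t](scalerK fz0) scalerA mulrC -scalerA.
apply: SZ; apply: Sidem; apply: alg_ext => x.
rewrite alg_mulE !alg_scaleE !tE !(functionalZ fL) !scalerA.
by congr (_ *: _); field.
Qed.

(** With [g y = 1], an operator [z (x) f] with [f z = 0] is a combination of
    operators of nonzero trace.  When [y (x) f] or [z (x) g] has trace zero, it
    differs by [y (x) g] from [y (x) (f + g)] or [(z + y) (x) g], of trace one.
    Then [z (x) f] is obtained by expanding [(z + y) (x) (f + g)] or
    [(z - y) (x) (f - g)], whose traces add up to [2], so that at least one of
    them is nonzero. *)
Lemma rank_one_dual_pair N y g z f t : NN N -> N y -> pred_annihilator N g ->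
  g y = 1 -> N z -> pred_annihilator N f -> (forall x, t x = f x *: z) -> S t.
Proof.
move=> NNN Ny gN gy Nz fN tE; have [fB f0] := fN; have [gB g0] := gN.
have [/eqP fz|fz] := boolP (f z == 0); last exact: rank_one_nonzero_trace tE fz.
have fD := functionalD fB.1; have gD := functionalD gB.1.
have fV := functionalN fB.1; have gV := functionalN gB.1.
have DB := bounded_functionalD.
have NB := bounded_functionalN.
have subN := nest_subspace NNN.
have fgN : pred_annihilator N (fun x => f x + g x).
  by split=> [|x Px]; [exact: DB|rewrite f0// g0// addr0].
have fgN' : pred_annihilator N (fun x => f x - g x).
  by split=> [|x Px]; [apply: DB => //; exact: NB|rewrite f0// g0// subr0].
have y0 : g y != 0 by rewrite gy oner_eq0.
have [yg ygE] := rank_one_in NNN Ny gN.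
have Syg : S yg by exact: rank_one_nonzero_trace ygE y0.
have [yf yfE] := rank_one_in NNN Ny fN.
have Syf : S yf.
  have [/eqP fy|fy] := boolP (f y == 0); last exact: rank_one_nonzero_trace yfE fy.
  have [s sE] := rank_one_in NNN Ny fgN.
  have -> : yf = s - yg.
    by apply: alg_ext => x; rewrite alg_subE sE yfE ygE scalerDl addrK.
  apply: SB => //; apply: rank_one_nonzero_trace (fgN.1) sE _.
  by rewrite fy add0r.
have [zg zgE] := rank_one_in NNN Nz gN.
have Szg : S zg.
  have [/eqP gz|gz] := boolP (g z == 0); last exact: rank_one_nonzero_trace zgE gz.
  have [s sE] := rank_one_in NNN (subspaceD subN Nz Ny) gN.
  have -> : zg = s - yg.
    by apply: alg_ext => x; rewrite alg_subE sE zgE ygE scalerDr addrK.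
  apply: SB => //; apply: rank_one_nonzero_trace gB sE _.
  by rewrite gD gz add0r.
have [p pE] := rank_one_in NNN (subspaceD subN Nz Ny) fgN.
have [m mE] := rank_one_in NNN (subspaceB subN Nz Ny) fgN'.
have [/eqP q0|q0] := boolP (f (z + y) + g (z + y) == 0).
  have Sm : S m.
    apply: rank_one_nonzero_trace (fgN'.1) mE _.
    rewrite fD gD fV gV; move: q0; rewrite fD gD fz gy.
    move=> q0; have -> : 0 - f y - (g z - 1) = 2 - (0 + f y + (g z + 1)) by ring.
    by rewrite q0 subr0 pnatr_eq0.
  have -> : t = m + zg + yf - yg.
    apply: alg_ext => x; rewrite alg_subE !alg_addE tE mE zgE yfE ygE.
    rewrite scalerBr !scalerBl opprB [(_ - _ + _) + _]addrAC subrK.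
    by rewrite -[(_ + _) + f x *: y]addrA subrK addrK.
  by apply: SB => //; apply: SD => //; exact: SD.
have -> : t = p - zg - yf - yg.
  apply: alg_ext => x; rewrite !alg_subE tE pE zgE yfE ygE.
  rewrite scalerDr !scalerDl -[_ - _ - _ - _]addrA -opprD.
  by rewrite [_ - g x *: z]addrAC !addrK.
have Sp : S p by exact: rank_one_nonzero_trace (fgN.1) pE q0.
by do 3 (apply: SB => //).
Qed.

End IdempotentSpan.
End NestAlgebra.

Section Banach.
Variables (R : realType) (is_complex : bool).
Local Notation K := (scalars R is_complex).
Variables (X : completeNormedModType K) (NN : nest X).
Local Notation A := (Alg NN).
Implicit Types (N : set X) (s t e : A) (f : X -> K).
Variable S : set A.
Hypothesis SB : forall s t, S s -> S t -> S (s - t).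
Hypothesis SZ : forall (c : K) s, S s -> S (c *: s).
Hypothesis Sidem : forall e, e * e = e -> S e.
Hypothesis hcompl : forall N, NN N -> nest_pred NN N = N -> complemented N.

(** When [N_- = N], the functional [f] vanishes on [N], and adding [z (x) f] to
    a projection onto [N] gives another projection onto [N].  When [N_- != N], a
    dual pair for the preceding lemma comes from separating a point of [N] from
    [N_-]. *)
Theorem rank_one_idempotent_span N z f t : NN N -> N z ->
  pred_annihilator NN N f -> (forall x, t x = f x *: z) -> S t.
Proof.
move=> NNN Nz fN tE; have [fB f0] := fN.
have cN := nest_closed_subspace (nestP NN).
have [NE|NN_] := pselect (nest_pred NN N = N).
  have [p [pB pN pid]] := bounded_projection (cN N NNN) (hcompl NNN NE).
  have [e eE] : exists e : A, forall x, e x = p x.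
    by exists (MkAlg (projection_in NNN pB pN pid)).
  have eN x : N x -> e x = x by move=> Nx; rewrite eE pid.
  have Ne x : N (e x) by rewrite eE.
  have fN0 x : N x -> f x = 0 by move=> Nx; apply: f0; rewrite NE.
  have -> : t = e + t - e by rewrite addrAC subrr add0r.
  apply: SB; apply: Sidem; apply: alg_ext => x.
    rewrite alg_mulE !alg_addE !algD !tE (eN (e x))// algZ (eN z)//.
    by rewrite (fN0 (e x))// (functionalZ fB.1) (fN0 z)// mulr0 !scale0r !addr0.
  by rewrite alg_mulE eN.
have [y [Ny yN]] : exists y, N y /\ ~ nest_pred NN N y.
  apply: contrapT => /forallNP noy; apply: NN_; apply/seteqP; split.
    exact: nest_pred_sub.
  by move=> y Ny; apply: contrapT => yN; apply: (noy y).
have [g [gB g0 gy]] := separating_functional (cN _ (nest_pred_in NN N)) yN.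
have gN : pred_annihilator NN N g by [].
exact: (rank_one_dual_pair SB SZ Sidem NNN Ny gN gy Nz fN tE).
Qed.

End Banach.

(** * Local centralizers *)

Section Kernel.
Variables (K : numFieldType) (X : normedModType K) (NN : nest X).

Lemma alg_kernel_closed_subspace (t : Alg NN) : closed_subspace [set x | t x = 0].
Proof.
split; first apply/subspaceP.
  split=> [|c x y /= tx ty]; first exact: alg0.
  by rewrite algD algZ tx ty scaler0 addr0.
move=> x /closure_distP clx /=; apply: contrapT => /eqP tx0.
have [C C0 tC] := alg_bounded t.
(* The bound [C] may be [0], and is replaced by [C + 1] to divide by it. *)
have C1 : 0 < C + 1 by rewrite ltr_wpDl.
have tx : 0 < `|t x| by rewrite normr_gt0.
have [y /= ty xy] := clx _ (divr_gt0 tx C1).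
have : `|t x| <= C * (`|t x| / (C + 1)).
  rewrite -[t x]subr0 -ty -algB (le_trans (tC _))// algB ty subr0.
  by rewrite ler_wpM2l// ltW.
by apply/negP; rewrite lt_geF// mulrCA gtr_pMr// ltr_pdivrMr// mul1r ltrDl.
Qed.

End Kernel.

Section LocalCentralizers.
Variables (R : realType) (is_complex : bool).
Local Notation K := (scalars R is_complex).
Variables (X : completeNormedModType K) (NN : nest X).
Hypothesis hcompl :
  forall N : set X, NN N -> nest_pred NN N = N -> complemented N.
Local Notation A := (Alg NN).
Implicit Types (N M : set X) (r s t e a b : A) (f : X -> K).

(** Since [(z (x) f) * t] maps [x] to [f (t x) *: z], the hypothesis says that
    [t x] is annihilated by all bounded functionals that vanish on [N_-], for each
    nonzero [N].  The intersection [P] of the nonzero members of the nest is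
    either [0], or the smallest of them, and then [P_-] is [0]. *)
Lemma right_separation t : (forall N z f r, NN N -> N z ->
    pred_annihilator NN N f -> (forall x, r x = f x *: z) -> r * t = 0) -> t = 0.
Proof.
move=> rt0; apply: alg_ext => x.
have cN := nest_closed_subspace (nestP NN).
have tpred N : NN N -> N <> [set 0] -> nest_pred NN N (t x).
  move=> NNN N0; apply: contrapT => ntx.
  have [f [fB f0 ftx]] := separating_functional (cN _ (nest_pred_in NN N)) ntx.
  have [z [Nz z0]] : exists z, N z /\ z != 0.
    apply: contrapT => /forallNP noz; apply: N0; apply/seteqP; split=> [z Nz|_ ->].
      by apply: contrapT => /eqP z0; apply: (noz z).
    exact: subspace0 (nest_subspace NNN).
  have fN : pred_annihilator NN N f by [].
  have [r rE] := rank_one_in NNN Nz fN.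
  have : (r * t) x = 0 by rewrite (rt0 N z f r).
  by rewrite alg_mulE rE ftx scale1r; apply/eqP.
pose P := \bigcap_(N in [set N | NN N /\ N <> [set 0]]) N.
have NNP : NN P by apply: (nest_bigcap (nestP NN)) => N [].
have [P0|P0] := pselect (P = [set 0]).
  suff : P (t x) by rewrite P0.
  by move=> N [NNN N0]; apply: (nest_pred_sub NNN); exact: tpred.
apply: (closed_span_sub (cN _ (nest_zero (nestP NN))) _ (tpred P NNP P0)).
move=> z [M [NNM [MP PM]] Mz].
have [M0|M0] := pselect (M = [set 0]); first by rewrite M0 in Mz.
by exfalso; apply: PM => y; apply.
Qed.

(** Since [t * (z (x) f)] maps [x] to [f x *: t z], the hypothesis says that [t]
    vanishes on each [N] with [N_-] different from the whole space.  When the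
    whole space is not such an [N], it is the closed span of the smaller
    members, each of which is. *)
Lemma left_separation t : (forall N z f r, NN N -> N z ->
    pred_annihilator NN N f -> (forall x, r x = f x *: z) -> t * r = 0) -> t = 0.
Proof.
move=> rt0; apply: alg_ext => x.
have cN := nest_closed_subspace (nestP NN).
have tN N y z : NN N -> ~ nest_pred NN N y -> N z -> t z = 0.
  move=> NNN ny Nz.
  have [f [fB f0 fy]] := separating_functional (cN _ (nest_pred_in NN N)) ny.
  have fN : pred_annihilator NN N f by [].
  have [r rE] := rank_one_in NNN Nz fN.
  have : (t * r) y = 0 by rewrite (rt0 N z f r).
  by rewrite alg_mulE rE fy scale1r.
have NNT := nest_full (nestP NN).
have [XT|/existsNP[y ny]] := pselect (forall y, nest_pred NN setT y); last first.
  exact: tN ny _.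
apply: (closed_span_sub (alg_kernel_closed_subspace t) _ (XT x)).
move=> z [M [NNM [MT TM]] Mz].
have [y My] : exists y, ~ M y by apply/existsNP => MA; apply: TM => y _.
by apply: (tN M y) => // /(nest_pred_sub NNM).
Qed.

Variable psi : {linear A -> A}.

(** For a rank one [r] of the algebra, [r * a] is again of this form, and both
    are combinations of idempotents, so that
    [r * psi a = psi (r * a * 1) = r * (a * psi 1)]. *)
Lemma local_right_centralizer_right :
  local_right_centralizer psi -> right_centralizer psi.
Proof.
move=> psiloc.
have psiP a : exists b, psi a = a * b.
  by have [rho rhoR ->] := psiloc a; exists (rho 1); rewrite -rhoR mulr1.
have S1 N z f r : NN N -> N z -> pred_annihilator NN N f ->
    (forall x, r x = f x *: z) -> forall b, psi (r * b) = r * psi b.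
  move=> NNN Nz fN rE.
  apply: (@rank_one_idempotent_span _ _ _ _ [set t | forall b, psi (t * b) = t * psi b]
    _ _ _ hcompl N z f r) => //=.
  - by move=> s t sP tP b; rewrite !mulrBl raddfB/= sP tP.
  - by move=> c s sP b; rewrite -!alg_scalerAl linearZ/= sP.
  - by move=> e ee; exact: local_right_idempotentM.
have psi1 a : psi a = a * psi 1.
  apply/eqP; rewrite -subr_eq0; apply/eqP; apply: right_separation.
  move=> N z f r NNN Nz fN rE; rewrite mulrBr -(S1 N z f r)// mulrA.
  have [fB f0] := fN; have [fL [C C0 fC]] := fB.
  have faN : pred_annihilator NN N (fun x => f (a x)).
    split=> [|x Px]; last by rewrite f0//; apply: (alg_invariant _ (nest_pred_in NN N)).
    split=> [c x y|]; first by rewrite alg_linear fL.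
    have [D D0 aD] := alg_bounded a.
    exists (C * D) => [|x]; first exact: mulr_ge0.
    by rewrite (le_trans (fC _))// -mulrA ler_wpM2l.
  rewrite -(S1 N z _ (r * a) NNN Nz faN) ?mulr1 ?subrr// => x.
  by rewrite alg_mulE rE.
by move=> a b; rewrite psi1 [psi b]psi1 mulrA.
Qed.

Lemma local_left_centralizer_left :
  local_left_centralizer psi -> left_centralizer psi.
Proof.
move=> psiloc.
have psiP a : exists b, psi a = b * a.
  by have [rho rhoL ->] := psiloc a; exists (rho 1); rewrite -rhoL mul1r.
have S1 N z f r : NN N -> N z -> pred_annihilator NN N f ->
    (forall x, r x = f x *: z) -> forall b, psi (b * r) = psi b * r.
  move=> NNN Nz fN rE.
  apply: (@rank_one_idempotent_span _ _ _ _ [set t | forall b, psi (b * t) = psi b * t]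
    _ _ _ hcompl N z f r) => //=.
  - by move=> s t sP tP b; rewrite !mulrBr raddfB/= sP tP.
  - by move=> c s sP b; rewrite -!alg_scalerAr linearZ/= sP.
  - by move=> e ee; exact: local_left_idempotentM.
have psi1 a : psi a = psi 1 * a.
  apply/eqP; rewrite -subr_eq0; apply/eqP; apply: left_separation.
  move=> N z f r NNN Nz fN rE; rewrite mulrBl -(S1 N z f r)// -mulrA.
  rewrite -(S1 N (a z) f (a * r)) ?mul1r ?subrr//; first exact: alg_invariant.
  by move=> x; rewrite alg_mulE rE algZ.
by move=> a b; rewrite psi1 [psi a]psi1 mulrA.
Qed.

End LocalCentralizers.

Theorem corollary3p4 (R : realType) (is_complex : bool)
    (X : completeNormedModType (scalars R is_complex)) (hdim : dim_ge2 X)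
    (NN : nest X)
    (hcompl : forall N : set X, NN N -> nest_pred NN N = N -> complemented N)
    (psi : {linear Alg NN -> Alg NN}) :
  (local_right_centralizer psi <-> right_centralizer psi) /\
  (local_left_centralizer psi <-> left_centralizer psi).
Proof.
split; split.
- exact: local_right_centralizer_right.
- by move=> psiR a; exists psi.
- exact: local_left_centralizer_left.
- by move=> psiL a; exists psi.
Qed.
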